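(* Every metrizable space $X$ has a uniform Eberlein compactification, i.e. there is a uniform Eberlein compact space $K$ containing a dense subspace homeomorphic to $X$.
   Context: A compact space is uniform Eberlein if it is homeomorphic to a compact subset of a Hilbert space endowed with its weak topology. A compactification of a space $X$ is a compact Hausdorff space containing (a homeomorphic copy of) $X$ as a dense subspace. *)

(* Defs.v *)
From Stdlib Require Import Reals List Lra.
Open Scope R_scope.

Record TopSpace := {
  carrier :> Type;
  is_open : (carrier -> Prop) -> Prop;
  open_full : is_open (fun _ => True);
  open_inter : forall U V, is_open U -> is_open V -> is_open (fun x => U x /\ V x);
  open_union : forall F : (carrier -> Prop) -> Prop,
      (forall U, F U -> is_open U) -> is_open (fun x => exists U, F U /\ U x)
}.

Definition continuous {X Y : TopSpace} (f : X -> Y) : Prop :=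
  forall V : Y -> Prop, is_open Y V -> is_open X (fun x => V (f x)).

Definition embedding {X Y : TopSpace} (f : X -> Y) : Prop :=
  (forall x1 x2, f x1 = f x2 -> x1 = x2) /\
  continuous f /\
  (forall U : X -> Prop, is_open X U ->
     exists V : Y -> Prop, is_open Y V /\ forall x, U x <-> V (f x)).

Definition dense {X : TopSpace} (S : X -> Prop) : Prop :=
  forall U : X -> Prop, is_open X U -> (exists x, U x) -> exists x, U x /\ S x.

Definition compact_set {X : TopSpace} (S : X -> Prop) : Prop :=
  forall F : (X -> Prop) -> Prop,
    (forall U, F U -> is_open X U) ->
    (forall x, S x -> exists U, F U /\ U x) ->
    exists l : list (X -> Prop),
      (forall U, In U l -> F U) /\ (forall x, S x -> exists U, In U l /\ U x).

Definition compact (X : TopSpace) : Prop := compact_set (fun _ : X => True).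

Definition hausdorff (X : TopSpace) : Prop :=
  forall x y : X, x <> y -> exists U V : X -> Prop,
    is_open X U /\ is_open X V /\ U x /\ V y /\ forall z, ~ (U z /\ V z).

Definition is_metric {T : Type} (d : T -> T -> R) : Prop :=
  (forall x y, 0 <= d x y) /\
  (forall x y, d x y = 0 <-> x = y) /\
  (forall x y, d x y = d y x) /\
  (forall x y z, d x z <= d x y + d y z).

Definition metrizable (X : TopSpace) : Prop :=
  exists d : X -> X -> R, is_metric d /\
    forall U : X -> Prop, is_open X U <->
      (forall x, U x -> exists eps, 0 < eps /\ forall y, d x y < eps -> U y).

Record Hilbert := {
  hcar :> Type;
  hzero : hcar;
  hadd : hcar -> hcar -> hcar;
  hopp : hcar -> hcar;
  hscal : R -> hcar -> hcar;
  inner : hcar -> hcar -> R;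
  hadd_assoc : forall x y z, hadd x (hadd y z) = hadd (hadd x y) z;
  hadd_comm : forall x y, hadd x y = hadd y x;
  hadd_0 : forall x, hadd hzero x = x;
  hadd_opp : forall x, hadd x (hopp x) = hzero;
  hscal_1 : forall x, hscal 1 x = x;
  hscal_assoc : forall a b x, hscal a (hscal b x) = hscal (a * b) x;
  hscal_distr_v : forall a x y, hscal a (hadd x y) = hadd (hscal a x) (hscal a y);
  hscal_distr_s : forall a b x, hscal (a + b) x = hadd (hscal a x) (hscal b x);
  inner_sym : forall x y, inner x y = inner y x;
  inner_add_l : forall x y z, inner (hadd x y) z = inner x z + inner y z;
  inner_scal_l : forall a x y, inner (hscal a x) y = a * inner x y;
  inner_pos : forall x, 0 <= inner x x;
  inner_def : forall x, inner x x = 0 -> x = hzero;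
  hcomplete : forall u : nat -> hcar,
    (forall eps, 0 < eps -> exists N, forall m n, (N <= m)%nat -> (N <= n)%nat ->
        sqrt (inner (hadd (u m) (hopp (u n))) (hadd (u m) (hopp (u n)))) < eps) ->
    exists l, forall eps, 0 < eps -> exists N, forall n, (N <= n)%nat ->
        sqrt (inner (hadd (u n) (hopp l)) (hadd (u n) (hopp l))) < eps
}.

(* Weak topology sigma(H, H^* ) on H; by Riesz, H^* = { <., y> : y in H }.
   U is weakly open iff each x in U has a basic weak neighbourhood
   { z | forall y in ys, |<z - x, y>| < eps } inside U. *)
Definition weak_open (H : Hilbert) (U : H -> Prop) : Prop :=
  forall x, U x -> exists (ys : list (hcar H)) (eps : R), 0 < eps /\
    forall z, (forall y, In y ys -> Rabs (inner H (hadd H z (hopp H x)) y) < eps) -> U z.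

Lemma weak_open_full (H : Hilbert) : weak_open H (fun _ => True).
Proof. intros x _. exists nil, 1. split; [lra|]. auto. Qed.

Lemma weak_open_inter (H : Hilbert) (U V : hcar H -> Prop) :
  weak_open H U -> weak_open H V -> weak_open H (fun x => U x /\ V x).
Proof.
  intros hU hV x [Ux Vx].
  destruct (hU x Ux) as [ys1 [e1 [he1 h1]]].
  destruct (hV x Vx) as [ys2 [e2 [he2 h2]]].
  exists (ys1 ++ ys2), (Rmin e1 e2). split.
  - apply Rmin_pos; assumption.
  - intros z hz. split.
    + apply h1. intros y hy. eapply Rlt_le_trans.
      apply hz. apply in_or_app; auto. apply Rmin_l.
    + apply h2. intros y hy. eapply Rlt_le_trans.
      apply hz. apply in_or_app; auto. apply Rmin_r.
Qed.

Lemma weak_open_union (H : Hilbert) (F : (hcar H -> Prop) -> Prop) :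
  (forall U, F U -> weak_open H U) -> weak_open H (fun x => exists U, F U /\ U x).
Proof.
  intros hF x [U [FU Ux]].
  destruct (hF U FU x Ux) as [ys [e [he h]]].
  exists ys, e. split; auto. intros z hz. exists U. split; auto.
Qed.

Definition weak (H : Hilbert) : TopSpace :=
  {| carrier := hcar H; is_open := weak_open H;
     open_full := weak_open_full H; open_inter := weak_open_inter H;
     open_union := weak_open_union H |}.

Definition uniform_eberlein (K : TopSpace) : Prop :=
  exists (H : Hilbert) (e : K -> weak H),
    embedding e /\ compact_set (fun h : weak H => exists k, e k = h).

Definition compactification (X K : TopSpace) : Prop :=
  compact K /\ hausdorff K /\
  exists e : X -> K, embedding e /\ dense (fun k : K => exists x, e x = k).

(* Main.v *)
(* Let d be a metric on X. For every scale r, a well-ordering of X yields continuous functions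
   h_s >= 0 (s in X), each supported in the r-ball around s, not all vanishing at any point, with
   sum at most r. Taking r = 2^-m for all m, the map x |-> (h_(m,s) x)_(m,s) sends X into a
   bounded subset of l2(nat * X). On bounded sets the weak topology of l2 is that of coordinatewise
   convergence, so the map is weakly continuous; it is an embedding because the sets
   {h_(m,s) > 0} form a base of X. The weak closure of its image is compact. *)
From Stdlib Require Import Reals List Lra Lia Permutation Classical ClassicalEpsilon
  FunctionalExtensionality ProofIrrelevance.
From mathcomp Require boolp wochoice filter.
Require Import Defs.

(** The difficulty is the size of the image, not continuity. At one scale a point may lie in
    infinitely many of the [r]-balls, so the plain bump functions [max 0 (r - d x s)] need not be
    summable over [s]. Replacing each bump by its increment over the earlier ones keeps the supports
    small and makes every finite sum telescope to at most [r]; no local finiteness is required,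
    since weak continuity only tests finitely many coordinates at a time. The scales [r = 2^-m] do
    not exceed 1, so each value dominates its own square, and the squared norms stay below the
    geometric sum 2. This uniform bound is used twice: it reduces weak neighbourhoods to
    coordinates, and it gives coordinatewise limits along ultrafilters, hence compactness. Sums over
    the possibly uncountable index set are unordered sums. *)

(** * Well-orderings and ultrafilters *)

Lemma well_order_exists (T : Type) : exists le : T -> T -> Prop,
  (forall x y z, le x y -> le y z -> le x z) /\
  (forall x y, le x y -> le y x -> x = y) /\
  (forall x y, le x y \/ le y x) /\
  (forall A : T -> Prop, (exists x, A x) -> exists z, A z /\ forall x, A x -> le z x).
Proof.
  destruct (wochoice.well_ordering_principle
    (boolp.boolp_classicType__canonical__eqtype_Equality T)) as [leb Hwo].
  assert (Hmin : forall A : T -> Prop, (exists x, A x) ->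
    exists z, (A z /\ forall x, A x -> is_true (leb z x)) /\
      forall z', (A z' /\ forall x, A x -> is_true (leb z' x)) -> z = z').
  { intros A [a Ha].
    destruct (Hwo (fun x => boolp.asbool (A x))) as [z [[Hz1 Hz2] Hz3]].
    { exists a. change (is_true (boolp.asbool (A a))). rewrite boolp.asboolE. exact Ha. }
    exists z. repeat split.
    - apply boolp.asboolW. exact Hz1.
    - intros x Hx. apply Hz2. change (is_true (boolp.asbool (A x))).
      rewrite boolp.asboolE. exact Hx.
    - intros z' [H1 H2]. apply Hz3. split.
      + change (is_true (boolp.asbool (A z'))). rewrite boolp.asboolE. exact H1.
      + intros x Hx. apply H2. apply boolp.asboolW. exact Hx. }
  set (le := fun x y => is_true (leb x y)).
  (* The library gives only unique least elements of nonempty sets. Totality and antisymmetry come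
     from two-element sets (existence and uniqueness respectively), transitivity from three-element
     sets. *)
  assert (Htot : forall x y, le x y \/ le y x).
  { intros x y. destruct (Hmin (fun z => z = x \/ z = y)) as [z [[[->| ->] H] _]].
    - exists x; auto.
    - left; apply H; auto.
    - right; apply H; auto. }
  assert (Hrefl : forall x, le x x) by (intros x; destruct (Htot x x); assumption).
  assert (Hanti : forall x y, le x y -> le y x -> x = y).
  { intros x y Hxy Hyx.
    destruct (Hmin (fun z => z = x \/ z = y)) as [z [_ H]]; [exists x; auto|].
    transitivity z; [symmetry|]; apply H; (split; [tauto|]); intros t [->| ->];
      first [apply Hrefl | assumption]. }
  exists le. repeat split; auto.
  - intros x y z Hxy Hyz.
    destruct (Hmin (fun t => t = x \/ t = y \/ t = z)) as [w [[[->|[->| ->]] H] _]];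
      [exists x; auto|..].
    + apply H; auto.
    + rewrite (Hanti x y); auto. apply H; auto.
    + rewrite (Hanti y z) in Hxy; auto. apply H; auto.
  - intros A HA. destruct (Hmin A HA) as [z [H _]]. eauto.
Qed.

Record ultrafilter {T : Type} (G : (T -> Prop) -> Prop) : Prop := {
  uf_nonempty : forall A, G A -> exists x, A x;
  uf_full : G (fun _ => True);
  uf_inter : forall A B, G A -> G B -> G (fun x => A x /\ B x);
  uf_mono : forall A B : T -> Prop, (forall x, A x -> B x) -> G A -> G B;
  uf_em : forall A, G A \/ G (fun x => ~ A x)
}.

Lemma ultrafilter_exists (T : Type) (F : (T -> Prop) -> Prop) :
  ~ F (fun _ => False) -> F (fun _ => True) ->
  (forall A B, F A -> F B -> F (fun x => A x /\ B x)) ->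
  (forall A B : T -> Prop, (forall x, A x -> B x) -> F A -> F B) ->
  exists G, ultrafilter G /\ forall A, F A -> G A.
Proof.
  intros H0 H1 H2 H3.
  assert (PF : filter.ProperFilter F).
  { constructor. exact H0. constructor. exact H1. exact H2. exact H3. }
  destruct (filter.ultraFilterLemma PF) as [G [UG FG]].
  exists G. split; [|exact FG].
  pose proof (filter.ultra_proper (UltraFilter := UG)) as PG.
  pose proof (filter.filter_filter (ProperFilter := PG)) as GG.
  constructor.
  - intros A HA. apply NNPP. intros N.
    apply (filter.filter_not_empty G).
    apply (filter.filterS (P := A)); [|exact HA]. intros x Hx. apply N. exists x; exact Hx.
  - exact (filter.filterT (F := G)).
  - intros A B HA HB. exact (filter.filterI HA HB).
  - intros A B HAB HA. exact (filter.filterS HAB HA).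
  - intros A. exact (filter.in_ultra_setVsetC (F := G) A UG).
Qed.

(** * Finite and unordered sums of real families *)

Fixpoint fsum {S : Type} (a : S -> R) (l : list S) : R :=
  match l with
  | nil => 0
  | s :: l' => a s + fsum a l'
  end.

Lemma fsum_add {S : Type} (a b : S -> R) l :
  fsum (fun s => a s + b s) l = fsum a l + fsum b l.
Proof. induction l as [|s l IH]; simpl; [|rewrite IH]; ring. Qed.

Lemma fsum_scal {S : Type} (a : S -> R) c l : fsum (fun s => c * a s) l = c * fsum a l.
Proof. induction l as [|s l IH]; simpl; [|rewrite IH]; ring. Qed.

Lemma fsum_app {S : Type} (a : S -> R) l l' : fsum a (l ++ l') = fsum a l + fsum a l'.
Proof. induction l as [|s l IH]; simpl; [|rewrite IH]; ring. Qed.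

Lemma fsum_perm {S : Type} (a : S -> R) l l' : Permutation l l' -> fsum a l = fsum a l'.
Proof. induction 1; simpl; lra. Qed.

Lemma fsum_le {S : Type} (a b : S -> R) l :
  (forall s, In s l -> a s <= b s) -> fsum a l <= fsum b l.
Proof.
  induction l as [|s l IH]; simpl; intros H; [lra|].
  pose proof (H s (or_introl eq_refl)). pose proof (IH (fun t Ht => H t (or_intror Ht))). lra.
Qed.

Lemma fsum_abs {S : Type} (a : S -> R) l : Rabs (fsum a l) <= fsum (fun s => Rabs (a s)) l.
Proof.
  induction l as [|s l IH]; simpl; [rewrite Rabs_R0; lra|].
  pose proof (Rabs_triang (a s) (fsum a l)). lra.
Qed.

Lemma fsum_nonneg {S : Type} (a : S -> R) l :
  (forall s, 0 <= a s) -> 0 <= fsum a l.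
Proof. intros H; induction l as [|s l IH]; simpl; [lra|]. pose proof (H s). lra. Qed.

(** Isolates the remainder [r] of a larger list, so that sums over [l] and [L] differ exactly by the
    sum over [r]. Without [NoDup l], a repeated entry could occur in [l] more often than in [L]. *)
Lemma incl_permutation {S : Type} (l L : list S) : NoDup l -> incl l L ->
  exists r, Permutation L (l ++ r).
Proof.
  revert L; induction l as [|s l IH]; intros L Hnd Hincl; [exists L; reflexivity|].
  inversion Hnd as [|? ? Hs Hl]; subst.
  destruct (in_split s L) as [L1 [L2 ->]]; [apply Hincl; left; reflexivity|].
  destruct (IH (L1 ++ L2) Hl) as [r Hr].
  { intros t Ht. pose proof (Hincl t (or_intror Ht)) as H. rewrite in_app_iff in *.
    simpl in H. destruct H as [H|[->|H]]; tauto. }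
  exists r. simpl. rewrite <- Permutation_middle. constructor. exact Hr.
Qed.

Lemma fsum_incl {S : Type} (a : S -> R) l L : (forall s, 0 <= a s) ->
  NoDup l -> incl l L -> fsum a l <= fsum a L.
Proof.
  intros Ha Hnd Hincl. destruct (incl_permutation l L Hnd Hincl) as [r Hr].
  rewrite (fsum_perm a _ _ Hr), fsum_app. pose proof (fsum_nonneg a r Ha). lra.
Qed.

Lemma exists_NoDup {S : Type} (l : list S) : exists l', NoDup l' /\ incl l l'.
Proof.
  set (dec := fun x y : S => excluded_middle_informative (x = y)).
  exists (nodup dec l). split; [apply NoDup_nodup|]. intros s Hs. apply nodup_In. exact Hs.
Qed.

(** Convergence along the net of finite subsets of [S], encoded as duplicate-free lists; it makes
    sense for uncountable [S]. *)
Definition is_sum {S : Type} (a : S -> R) (v : R) : Prop :=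
  forall eps, 0 < eps -> exists l0, forall l, NoDup l -> incl l0 l ->
    Rabs (fsum a l - v) < eps.

(** Closed balls contain limits. This turns an estimate uniform over all large finite lists into an
    estimate for the sum itself. *)
Lemma is_sum_ball {S : Type} (a : S -> R) v c B l0 : is_sum a v ->
  (forall l, NoDup l -> incl l0 l -> Rabs (fsum a l - c) <= B) -> Rabs (v - c) <= B.
Proof.
  intros Hv HB. apply Rnot_lt_le. intros Hlt.
  destruct (Hv (Rabs (v - c) - B)) as [l1 H1]; [lra|].
  destruct (exists_NoDup (l0 ++ l1)) as [l [Hnd Hl]].
  specialize (H1 l Hnd (fun s Hs => Hl s (in_or_app _ _ _ (or_intror Hs)))).
  specialize (HB l Hnd (fun s Hs => Hl s (in_or_app _ _ _ (or_introl Hs)))).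
  pose proof (Rabs_triang (v - fsum a l) (fsum a l - c)) as H.
  replace (v - fsum a l + (fsum a l - c)) with (v - c) in H by ring.
  rewrite (Rabs_minus_sym v (fsum a l)) in H. lra.
Qed.

Lemma is_sum_unique {S : Type} (a : S -> R) v w : is_sum a v -> is_sum a w -> v = w.
Proof.
  intros Hv Hw. apply NNPP. intros Hne.
  pose proof (Rabs_pos_lt (v - w) ltac:(lra)) as Hpos.
  destruct (Hw (Rabs (v - w) / 2)) as [l0 H0]; [lra|].
  pose proof (is_sum_ball a v w (Rabs (v - w) / 2) l0 Hv) as H. 
  assert (Rabs (v - w) <= Rabs (v - w) / 2); [|lra].
  apply H. intros l Hnd Hl. left. auto.
Qed.

Lemma is_sum_add {S : Type} (a b : S -> R) v w :
  is_sum a v -> is_sum b w -> is_sum (fun s => a s + b s) (v + w).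
Proof.
  intros Ha Hb eps Heps.
  destruct (Ha (eps / 2)) as [l1 H1]; [lra|]. destruct (Hb (eps / 2)) as [l2 H2]; [lra|].
  exists (l1 ++ l2). intros l Hnd Hl. rewrite fsum_add.
  specialize (H1 l Hnd (fun s Hs => Hl s (in_or_app _ _ _ (or_introl Hs)))).
  specialize (H2 l Hnd (fun s Hs => Hl s (in_or_app _ _ _ (or_intror Hs)))).
  pose proof (Rabs_triang (fsum a l - v) (fsum b l - w)).
  replace (fsum a l + fsum b l - (v + w)) with (fsum a l - v + (fsum b l - w)) by ring. lra.
Qed.

Lemma is_sum_scal {S : Type} (a : S -> R) c v :
  is_sum a v -> is_sum (fun s => c * a s) (c * v).
Proof.
  intros Ha eps Heps. pose proof (Rabs_pos c) as Hc.
  (* The [+ 1] keeps the divisor positive when [c = 0]. *)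
  destruct (Ha (eps / (Rabs c + 1))) as [l0 H0]; [apply Rdiv_lt_0_compat; lra|].
  exists l0. intros l Hnd Hl. specialize (H0 l Hnd Hl). rewrite fsum_scal.
  rewrite <- Rmult_minus_distr_l, Rabs_mult.
  apply Rle_lt_trans with (Rabs c * (eps / (Rabs c + 1))).
  - apply Rmult_le_compat_l; lra.
  - apply Rmult_lt_reg_r with (Rabs c + 1); [lra|]. field_simplify; [|lra]. nra.
Qed.

Lemma is_sum_nonneg_exists {S : Type} (a : S -> R) B : (forall s, 0 <= a s) ->
  (forall l, NoDup l -> fsum a l <= B) -> exists v, is_sum a v.
Proof.
  intros Ha HB.
  destruct (completeness (fun r => exists l, NoDup l /\ r = fsum a l)) as [v [Hub Hlub]].
  - exists B. intros r [l [Hnd ->]]. auto.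
  - exists 0, nil. split; [constructor|reflexivity].
  - exists v. intros eps Heps.
    assert (exists l, NoDup l /\ v - eps < fsum a l) as [l0 [Hnd0 H0]].
    { apply NNPP. intros N. assert (v <= v - eps); [|lra].
      apply Hlub. intros r [l [Hnd ->]]. apply Rnot_lt_le. intros Hlt. apply N. eauto. }
    exists l0. intros l Hnd Hl. pose proof (fsum_incl a l0 l Ha Hnd0 Hl).
    assert (fsum a l <= v) by (apply Hub; eauto).
    apply Rabs_def1; lra.
Qed.

Lemma is_sum_nonneg_ub {S : Type} (a : S -> R) v l : (forall s, 0 <= a s) ->
  is_sum a v -> NoDup l -> fsum a l <= v.
Proof.
  intros Ha Hv Hnd. apply Rnot_lt_le. intros Hlt.
  destruct (Hv (fsum a l - v)) as [l0 H0]; [lra|].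
  destruct (exists_NoDup (l ++ l0)) as [L [HndL HL]].
  specialize (H0 L HndL (fun s Hs => HL s (in_or_app _ _ _ (or_intror Hs)))).
  pose proof (fsum_incl a l L Ha Hnd (fun s Hs => HL s (in_or_app _ _ _ (or_introl Hs)))).
  apply Rabs_def2 in H0. lra.
Qed.

Lemma is_sum_le {S : Type} (a : S -> R) v B :
  (forall l, NoDup l -> fsum a l <= B) -> is_sum a v -> v <= B.
Proof.
  intros HB Hv. apply Rnot_lt_le. intros Hlt. destruct (Hv (v - B)) as [l0 H0]; [lra|].
  destruct (exists_NoDup l0) as [l [Hnd Hl]]. specialize (H0 l Hnd Hl). specialize (HB l Hnd).
  apply Rabs_def2 in H0. lra.
Qed.

(** * Square-summable families *)

Definition sq_bounded {S : Type} (f : S -> R) (B : R) : Prop :=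
  forall l, NoDup l -> fsum (fun s => f s * f s) l <= B.

Definition square_summable {S : Type} (f : S -> R) : Prop := exists B, sq_bounded f B.

(** The slack in each term is the square [(f s - c * g s)^2]. The parameter [c] serves sums,
    multiples and differences at once. *)
Lemma sq_bounded_comb {S : Type} (f g : S -> R) c A B : sq_bounded f A -> sq_bounded g B ->
  sq_bounded (fun s => f s + c * g s) (2 * A + 2 * (c * c) * B).
Proof.
  intros Hf Hg l Hnd. specialize (Hf l Hnd). specialize (Hg l Hnd).
  apply Rle_trans with (fsum (fun s => 2 * (f s * f s) + 2 * (c * c) * (g s * g s)) l).
  - apply fsum_le. intros s _. pose proof (Rle_0_sqr (f s - c * g s)). unfold Rsqr in *. nra.
  - rewrite fsum_add, !fsum_scal. pose proof (Rle_0_sqr c). unfold Rsqr in *. nra.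
Qed.

Lemma square_summable_comb {S : Type} (f g : S -> R) c :
  square_summable f -> square_summable g -> square_summable (fun s => f s + c * g s).
Proof. intros [A HA] [B HB]. eexists. apply sq_bounded_comb; eassumption. Qed.

(* Polarization reduces to the convergence of sums of squares. *)
Lemma dot_exists {S : Type} (f g : S -> R) : square_summable f -> square_summable g ->
  exists v, is_sum (fun s => f s * g s) v.
Proof.
  intros Hf Hg.
  assert (H : forall h : S -> R, square_summable h -> exists v, is_sum (fun s => h s * h s) v).
  { intros h [B HB]. apply is_sum_nonneg_exists with B; [|exact HB].
    intros s. apply Rle_0_sqr. }
  destruct (H _ (square_summable_comb f g 1 Hf Hg)) as [v Hv].
  destruct (H _ (square_summable_comb f g (-1) Hf Hg)) as [w Hw].
  exists (/ 4 * (v + -1 * w)).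
  replace (fun s => f s * g s) with (fun s => / 4 *
    ((f s + 1 * g s) * (f s + 1 * g s) + -1 * ((f s + -1 * g s) * (f s + -1 * g s)))).
  - apply is_sum_scal, is_sum_add; [exact Hv|]. apply is_sum_scal. exact Hw.
  - apply functional_extensionality. intros s. field.
Qed.

(** A finite sum of squares is continuous in its coordinates. This carries norm bounds over to
    coordinatewise limits, in the completeness of l2 as well as in the compactness argument. *)
Lemma fsum_sq_limit {S : Type} (x : S -> R) l B :
  (forall eps, 0 < eps -> exists z : S -> R,
     fsum (fun s => z s * z s) l <= B /\ forall s, In s l -> Rabs (z s - x s) < eps) ->
  fsum (fun s => x s * x s) l <= B.
Proof.
  intros H.
  assert (Hc : forall m, 0 < m -> exists eps, 0 < eps /\ forall z : S -> R,
    (forall s, In s l -> Rabs (z s - x s) < eps) ->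
    fsum (fun s => x s * x s) l <= fsum (fun s => z s * z s) l + m).
  { clear H. induction l as [|s l IH]; intros m Hm.
    - exists 1. split; [lra|]. simpl. intros; lra.
    - destruct (IH (m / 2)) as [e [He H]]; [lra|].
      pose proof (Rabs_pos (x s)) as Hx.
      (* Chosen so that [2 * (Rabs (x s) * e1) <= m / 2]; the other half of [m] is left for the tail
         of the list. *)
      set (e1 := m / (4 * (Rabs (x s) + 1))).
      assert (He1 : 0 < e1) by (apply Rdiv_lt_0_compat; lra).
      assert (He1' : e1 * (4 * (Rabs (x s) + 1)) = m) by (unfold e1; field; lra).
      exists (Rmin e e1). split; [apply Rmin_pos; assumption|].
      intros z Hz. simpl.
      assert (Hzs : Rabs (z s - x s) < e1).
      { eapply Rlt_le_trans; [apply Hz; left; reflexivity|apply Rmin_r]. }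
      assert (fsum (fun s => x s * x s) l <= fsum (fun s => z s * z s) l + m / 2).
      { apply H. intros t Ht. eapply Rlt_le_trans; [apply Hz; right; exact Ht|apply Rmin_l]. }
      (* Expand [z s] around [x s] and drop the square of [z s - x s]. *)
      assert (x s * x s <= z s * z s + 2 * (Rabs (x s) * Rabs (z s - x s))).
      { rewrite <- Rabs_mult. pose proof (Rle_abs (- (x s * (z s - x s)))) as Ha.
        rewrite Rabs_Ropp in Ha. pose proof (Rle_0_sqr (z s - x s)). unfold Rsqr in *. nra. }
      nra. }
  apply Rnot_lt_le. intros Hlt.
  destruct (Hc ((fsum (fun s => x s * x s) l - B) / 2)) as [e [He He']]; [lra|].
  destruct (H e He) as [z [Hz1 Hz2]]. specialize (He' z Hz2). lra.
Qed.

(** * The Hilbert space l2(S) *)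

Definition l2_car (S : Type) : Type := {f : S -> R | square_summable f}.

Definition l2_val {S : Type} (f : l2_car S) : S -> R := proj1_sig f.
Coercion l2_val : l2_car >-> Funclass.

(** The axioms of [Hilbert] are Leibniz equalities; this reduces the vector space ones to identities
    between reals. *)
Lemma l2_eq {S : Type} (f g : l2_car S) : (forall s, f s = g s) -> f = g.
Proof.
  destruct f as [f Hf], g as [g Hg]. simpl. intros H.
  assert (f = g) as <- by (apply functional_extensionality; exact H).
  f_equal. apply proof_irrelevance.
Qed.

Lemma square_summable_0 {S : Type} : square_summable (fun _ : S => 0).
Proof.
  exists 0. intros l _. apply Req_le. induction l as [|s l IH]; simpl; lra.
Qed.

Lemma square_summable_scal {S : Type} (f : S -> R) c :
  square_summable f -> square_summable (fun s => c * f s).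
Proof.
  intros Hf. replace (fun s => c * f s) with (fun s => 0 + c * f s).
  - apply (square_summable_comb (fun _ => 0)); [apply square_summable_0|exact Hf].
  - apply functional_extensionality. intros s. ring.
Qed.

Lemma square_summable_add {S : Type} (f g : S -> R) :
  square_summable f -> square_summable g -> square_summable (fun s => f s + g s).
Proof.
  intros Hf Hg. replace (fun s => f s + g s) with (fun s => f s + 1 * g s).
  - apply square_summable_comb; assumption.
  - apply functional_extensionality. intros s. ring.
Qed.

Definition l2_zero {S : Type} : l2_car S := exist _ _ square_summable_0.
Definition l2_add {S : Type} (f g : l2_car S) : l2_car S :=
  exist _ _ (square_summable_add f g (proj2_sig f) (proj2_sig g)).
Definition l2_scal {S : Type} (c : R) (f : l2_car S) : l2_car S :=
  exist _ _ (square_summable_scal f c (proj2_sig f)).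
Definition l2_opp {S : Type} (f : l2_car S) : l2_car S := l2_scal (-1) f.
Definition l2_dot {S : Type} (f g : l2_car S) : R :=
  proj1_sig (constructive_indefinite_description _
    (dot_exists f g (proj2_sig f) (proj2_sig g))).

Lemma l2_dot_spec {S : Type} (f g : l2_car S) : is_sum (fun s => f s * g s) (l2_dot f g).
Proof. exact (proj2_sig (constructive_indefinite_description _ _)). Qed.

Lemma l2_dot_eq {S : Type} (f g : l2_car S) v : is_sum (fun s => f s * g s) v -> l2_dot f g = v.
Proof. intros H. exact (is_sum_unique _ _ _ (l2_dot_spec f g) H). Qed.

Lemma l2_dot_sym {S : Type} (f g : l2_car S) : l2_dot f g = l2_dot g f.
Proof.
  apply l2_dot_eq. replace (fun s => f s * g s) with (fun s => g s * f s).
  - apply l2_dot_spec.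
  - apply functional_extensionality. intros s. ring.
Qed.

Lemma l2_dot_add {S : Type} (f g h : l2_car S) :
  l2_dot (l2_add f g) h = l2_dot f h + l2_dot g h.
Proof.
  apply l2_dot_eq.
  replace (fun s => l2_add f g s * h s) with (fun s => f s * h s + g s * h s).
  - apply is_sum_add; apply l2_dot_spec.
  - apply functional_extensionality. intros s. simpl. ring.
Qed.

Lemma l2_dot_scal {S : Type} c (f g : l2_car S) : l2_dot (l2_scal c f) g = c * l2_dot f g.
Proof.
  apply l2_dot_eq.
  replace (fun s => l2_scal c f s * g s) with (fun s => c * (f s * g s)).
  - apply is_sum_scal, l2_dot_spec.
  - apply functional_extensionality. intros s. simpl. ring.
Qed.

Lemma l2_dot_bounded {S : Type} (f : l2_car S) : sq_bounded f (l2_dot f f).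
Proof.
  intros l Hl. apply (is_sum_nonneg_ub (fun s => f s * f s)).
  - intros s. apply Rle_0_sqr.
  - apply l2_dot_spec.
  - exact Hl.
Qed.

Lemma l2_dot_le {S : Type} (f : l2_car S) B : sq_bounded f B -> l2_dot f f <= B.
Proof. intros H. exact (is_sum_le _ _ _ H (l2_dot_spec f f)). Qed.

Lemma sq_bounded_coord {S : Type} (f : S -> R) B s : sq_bounded f B -> f s * f s <= B.
Proof.
  intros H. specialize (H (s :: nil)). simpl in H. rewrite Rplus_0_r in H.
  apply H. constructor; [intros []|constructor].
Qed.

Lemma l2_dot_pos {S : Type} (f : l2_car S) : 0 <= l2_dot f f.
Proof. apply (l2_dot_bounded f nil). constructor. Qed.

Lemma l2_dot_def {S : Type} (f : l2_car S) : l2_dot f f = 0 -> f = l2_zero.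
Proof.
  intros H. apply l2_eq. intros s. simpl.
  pose proof (sq_bounded_coord f _ s (l2_dot_bounded f)) as Hs. rewrite H in Hs.
  pose proof (Rle_0_sqr (f s)). unfold Rsqr in *. nra.
Qed.

Lemma sqrt_lt_sq a e : 0 <= a -> 0 < e -> (sqrt a < e <-> a < e * e).
Proof.
  intros Ha He. split; intros H.
  - rewrite <- (sqrt_sqrt a Ha). pose proof (sqrt_pos a). nra.
  - apply Rnot_le_lt. intros N. pose proof (sqrt_sqrt a Ha). nra.
Qed.

Lemma l2_complete {S : Type} (u : nat -> l2_car S) :
  (forall eps, 0 < eps -> exists N, forall m n, (N <= m)%nat -> (N <= n)%nat ->
     sqrt (l2_dot (l2_add (u m) (l2_opp (u n))) (l2_add (u m) (l2_opp (u n)))) < eps) ->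
  exists l, forall eps, 0 < eps -> exists N, forall n, (N <= n)%nat ->
     sqrt (l2_dot (l2_add (u n) (l2_opp l)) (l2_add (u n) (l2_opp l))) < eps.
Proof.
  intros Hu.
  assert (Hb : forall eps, 0 < eps -> exists N, forall m n, (N <= m)%nat -> (N <= n)%nat ->
    sq_bounded (l2_add (u m) (l2_opp (u n))) (eps * eps)).
  { intros eps Heps. destruct (Hu eps Heps) as [N HN]. exists N. intros m n Hm Hn l Hl.
    specialize (HN m n Hm Hn). apply sqrt_lt_sq in HN; [|apply l2_dot_pos|exact Heps].
    eapply Rle_trans; [apply l2_dot_bounded, Hl|lra]. }
  assert (Hc : forall s, exists x, Un_cv (fun n => u n s) x).
  { intros s. destruct (R_complete (fun n => u n s)) as [x Hx]; [|exists x; exact Hx].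
    intros eps Heps. destruct (Hb (eps / 2)) as [N HN]; [lra|]. exists N.
    intros m n Hm Hn. pose proof (sq_bounded_coord _ _ s (HN m n Hm Hn)) as H. simpl in H.
    unfold Rdist. replace (u m s - u n s) with (u m s + -1 * u n s) by ring.
    apply Rabs_def1; nra. }
  set (x := fun s => proj1_sig (constructive_indefinite_description _ (Hc s))).
  assert (Hx : forall s, Un_cv (fun n => u n s) (x s)).
  { intros s. exact (proj2_sig (constructive_indefinite_description _ (Hc s))). }
  (* Coordinatewise convergence is uniform on a finite list, so a single late index [m] serves all
     its entries. *)
  assert (Hl : forall l N eps, 0 < eps -> exists m, (N <= m)%nat /\
    forall s, In s l -> Rabs (u m s - x s) < eps).
  { intros l N eps Heps.
    assert (exists M, forall m, (M <= m)%nat -> forall s, In s l -> Rabs (u m s - x s) < eps)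
      as [M HM].
    { induction l as [|s l [M HM]]; [exists O; intros ? ? ? []|].
      destruct (Hx s eps Heps) as [M' HM']. exists (max M M').
      intros m Hm t [<-|Ht]; [apply HM'; lia|apply HM; [lia|exact Ht]]. }
    exists (max N M). split; [lia|]. apply HM. lia. }
  (* With [n] fixed, let [m] tend to infinity in the Cauchy estimate, on each finite list
     separately. *)
  assert (Hd : forall eps, 0 < eps -> exists N, forall n, (N <= n)%nat ->
    sq_bounded (fun s => u n s + -1 * x s) (eps * eps)).
  { intros eps Heps. destruct (Hb eps Heps) as [N HN]. exists N. intros n Hn l Hnd.
    apply fsum_sq_limit. intros e He. destruct (Hl l N e He) as [m [Hm Hms]].
    exists (l2_add (u n) (l2_opp (u m))). split; [apply HN; assumption|].
    intros s Hs. simpl. specialize (Hms s Hs). rewrite <- Rabs_Ropp in Hms.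
    replace (u n s + -1 * u m s - (u n s + -1 * x s)) with (- (u m s - x s)) by ring.
    exact Hms. }
  assert (Hxs : square_summable x).
  { destruct (Hd 1) as [N HN]; [lra|].
    (* The limit is [u N] minus a difference already known to be square summable. *)
    replace x with (fun s => u N s + -1 * (u N s + -1 * x s)).
    - apply square_summable_comb; [exact (proj2_sig (u N))|]. eexists. apply HN. lia.
    - apply functional_extensionality. intros s. ring. }
  exists (exist _ x Hxs). intros eps Heps. destruct (Hd (eps / 2)) as [N HN]; [lra|].
  exists N. intros n Hn. apply sqrt_lt_sq; [apply l2_dot_pos|exact Heps|].
  eapply Rle_lt_trans; [apply l2_dot_le, (HN n Hn)|nra].
Qed.

(** Transparent, because later proofs convert [hcar (l2 S)] and [inner (l2 S)] to [l2_car S] and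
    [l2_dot]. *)
Definition l2 (S : Type) : Hilbert.
Proof.
  refine {| hcar := l2_car S; hzero := l2_zero; hadd := l2_add; hopp := l2_opp;
    hscal := l2_scal; inner := l2_dot; inner_sym := l2_dot_sym; inner_add_l := l2_dot_add;
    inner_scal_l := l2_dot_scal; inner_pos := l2_dot_pos; inner_def := l2_dot_def;
    hcomplete := l2_complete |};
  intros; apply l2_eq; intros s; simpl; ring.
Defined.

(** * Weak topology on bounded subsets of l2, and compactness *)

Lemma uf_forall_in {T I : Type} (G : (T -> Prop) -> Prop) (P : I -> T -> Prop) (l : list I) :
  ultrafilter G -> (forall i, In i l -> G (P i)) -> G (fun x => forall i, In i l -> P i x).
Proof.
  intros UG. induction l as [|i l IH]; intros H.
  - apply (uf_mono G UG (fun _ => True)); [intros x _ i []|apply (uf_full G UG)].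
  - apply (uf_mono G UG (fun x => P i x /\ forall j, In j l -> P j x)).
    + intros x [H1 H2] j [<-|Hj]; auto.
    + apply (uf_inter G UG); [apply H; left; reflexivity|].
      apply IH. intros j Hj. apply H. right. exact Hj.
Qed.

(** The limit is the supremum of the [t] for which [t <= f z] holds on a set of [G]. For a level
    above it, the ultrafilter must contain the complementary set. *)
Lemma uf_limit {T : Type} (G : (T -> Prop) -> Prop) (f : T -> R) M : ultrafilter G ->
  G (fun z => Rabs (f z) <= M) ->
  exists x, forall eps, 0 < eps -> G (fun z => Rabs (f z - x) < eps).
Proof.
  intros UG HM.
  destruct (completeness (fun t => G (fun z => t <= f z))) as [x [Hub Hlub]].
  - exists M. intros t Ht.
    destruct (uf_nonempty G UG _ (uf_inter G UG _ _ HM Ht)) as [z [H1 H2]].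
    pose proof (Rle_abs (f z)). lra.
  - exists (- M). eapply (uf_mono G UG); [|exact HM]. intros z Hz. simpl in Hz.
    pose proof (Rle_abs (- f z)) as H. rewrite Rabs_Ropp in H. lra.
  - exists x. intros eps Heps.
    assert (exists t, x - eps < t /\ G (fun z => t <= f z)) as [t [Ht1 Ht2]].
    { apply NNPP. intros N. assert (x <= x - eps); [|lra].
      apply Hlub. intros t Ht. apply Rnot_lt_le. intros Hlt. apply N. eauto. }
    destruct (uf_em G UG (fun z => x + eps / 2 <= f z)) as [H|H].
    + specialize (Hub _ H). lra.
    + apply (uf_mono G UG (fun z => t <= f z /\ ~ x + eps / 2 <= f z)).
      * intros z [H1 H2]. apply Rabs_def1; lra.
      * apply (uf_inter G UG); assumption.
Qed.

(* On bounded sets the weak topology of l2 is that of pointwise convergence. *)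
Lemma weak_nbhd_coords_1 {S : Type} (y : l2_car S) B eps : 0 < eps ->
  exists (l : list S) delta, 0 < delta /\ forall w : l2_car S, sq_bounded w B ->
    (forall s, In s l -> Rabs (w s) < delta) -> Rabs (l2_dot w y) < eps.
Proof.
  intros Heps.
  pose proof (Rabs_pos B) as HB. pose proof (Rle_abs B) as HB'.
  set (c := eps / (4 * (Rabs B + 1))).
  assert (Hc : 0 < c) by (apply Rdiv_lt_0_compat; lra).
  assert (HcB : c * (4 * (Rabs B + 1)) = eps) by (unfold c; field; lra).
  (* Two partial sums within [c * eps / 2] of the limit differ by less than [c * eps]; this bounds
     the squares of [y] outside [l]. *)
  destruct (l2_dot_spec y y (c * eps / 2)) as [l0 H0]; [nra|].
  destruct (exists_NoDup l0) as [l [Hnd Hl]].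
  set (a := fsum (fun s => Rabs (y s)) l).
  assert (Ha : 0 <= a) by (apply fsum_nonneg; intros s; apply Rabs_pos).
  set (d := eps / (4 * (a + 1))).
  assert (Hd : 0 < d) by (apply Rdiv_lt_0_compat; lra).
  assert (Hda : d * (4 * (a + 1)) = eps) by (unfold d; field; lra).
  exists l, d. split; [exact Hd|]. intros w Hw Hwl.
  (* The entries in [l] contribute at most [d * a <= eps / 4], the others at most
     [(c * Rabs B + eps) / 2 <= 5 / 8 * eps]. The margin below [eps] makes up for the non-strict
     conclusion of [is_sum_ball]. *)
  assert (Rabs (l2_dot w y - 0) <= 7 / 8 * eps) as Hdot.
  2:{ rewrite Rminus_0_r in Hdot. lra. }
  apply (is_sum_ball _ _ _ _ l (l2_dot_spec w y)). intros L HL Hincl.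
  rewrite Rminus_0_r.
  destruct (incl_permutation l L Hnd Hincl) as [r Hr].
  assert (Hrnd : NoDup r).
  { apply (Permutation_NoDup Hr) in HL. exact (NoDup_app_remove_l _ _ HL). }
  assert (Hry : fsum (fun s => y s * y s) r <= c * eps).
  { pose proof (H0 l Hnd Hl) as H1. pose proof (H0 L HL (incl_tran Hl Hincl)) as H2.
    rewrite (fsum_perm _ _ _ Hr), fsum_app in H2. apply Rabs_def2 in H1, H2. lra. }
  rewrite (fsum_perm _ _ _ Hr), fsum_app.
  eapply Rle_trans; [apply Rabs_triang|].
  assert (H1 : Rabs (fsum (fun s => w s * y s) l) <= d * a).
  { eapply Rle_trans; [apply fsum_abs|]. unfold a. rewrite <- fsum_scal. apply fsum_le.
    intros s Hs. rewrite Rabs_mult. apply Rmult_le_compat_r; [apply Rabs_pos|].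
    left. auto. }
  assert (H2 : Rabs (fsum (fun s => w s * y s) r) <= (c * Rabs B + eps) / 2).
  { (* AM-GM: [2 |w y| <= c w^2 + y^2 / c] *)
    eapply Rle_trans; [apply fsum_abs|].
    apply Rle_trans with (fsum (fun s => c / 2 * (w s * w s) + / (2 * c) * (y s * y s)) r).
    - apply fsum_le. intros s _.
      apply Rmult_le_reg_l with (2 * c); [lra|]. field_simplify; [|lra].
      rewrite Rabs_mult. pose proof (Rle_0_sqr (c * Rabs (w s) - Rabs (y s))) as H.
      unfold Rsqr in H. rewrite <- (pow2_abs (w s)), <- (pow2_abs (y s)). nra.
    - rewrite fsum_add, !fsum_scal. specialize (Hw r Hrnd).
      assert (/ (2 * c) * fsum (fun s => y s * y s) r <= / (2 * c) * (c * eps)).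
      { apply Rmult_le_compat_l; [left; apply Rinv_0_lt_compat; lra|exact Hry]. }
      replace (/ (2 * c) * (c * eps)) with (eps / 2) in H by (field; lra).
      nra. }
  nra.
Qed.

Lemma weak_nbhd_coords {S : Type} (ys : list (l2_car S)) B eps : 0 < eps ->
  exists (l : list S) delta, 0 < delta /\ forall w : l2_car S, sq_bounded w B ->
    (forall s, In s l -> Rabs (w s) < delta) ->
    forall y, In y ys -> Rabs (l2_dot w y) < eps.
Proof.
  intros Heps. induction ys as [|y ys [l [d [Hd IH]]]].
  - exists nil, 1. split; [lra|]. intros w _ _ y [].
  - destruct (weak_nbhd_coords_1 y B eps Heps) as [l1 [d1 [Hd1 H1]]].
    exists (l ++ l1), (Rmin d d1). split; [apply Rmin_pos; assumption|].
    intros w Hw Hs z [<-|Hz].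
    + apply H1; [exact Hw|]. intros s Hs'.
      eapply Rlt_le_trans; [apply Hs, in_or_app; right; exact Hs'|apply Rmin_r].
    + apply IH; [exact Hw| |exact Hz]. intros s Hs'.
      eapply Rlt_le_trans; [apply Hs, in_or_app; left; exact Hs'|apply Rmin_l].
Qed.

Lemma weak_open_coords {S : Type} (V : l2_car S -> Prop) B (x : l2_car S) :
  weak_open (l2 S) V -> sq_bounded x B -> V x ->
  exists (l : list S) delta, 0 < delta /\ forall z : l2_car S, sq_bounded z B ->
    (forall s, In s l -> Rabs (z s - x s) < delta) -> V z.
Proof.
  (* Neighbourhoods of [x] are translated to 0; the bound is the one [sq_bounded_comb] gives for the
     difference [z - x]. *)
  intros HV Hx Vx. destruct (HV x Vx) as [ys [eps [Heps H]]].
  destruct (weak_nbhd_coords ys (2 * B + 2 * (-1 * -1) * B) eps Heps) as [l [d [Hd Hl]]].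
  exists l, d. split; [exact Hd|]. intros z Hz Hzx. apply H. apply Hl.
  - exact (sq_bounded_comb z x (-1) B B Hz Hx).
  - intros s Hs. simpl. replace (z s + -1 * x s) with (z s - x s) by ring. auto.
Qed.

(** An Alaoglu argument: an ultrafilter containing a bounded set converges in every coordinate, the
    limit obeys the same bound, and coordinatewise convergence is then weak convergence. *)
Lemma bounded_closed_compact {S : Type} (C : l2_car S -> Prop) B :
  (forall z, C z -> sq_bounded z B) ->
  (forall x : l2_car S, sq_bounded x B ->
     (forall V, weak_open (l2 S) V -> V x -> exists z, C z /\ V z) -> C x) ->
  compact_set (X := weak (l2 S)) C.
Proof.
  intros HB Hcl F HF Hcov. apply NNPP. intros Hno.
  (* [covers A l] says that [l], a finite part of [F], covers [C] outside [A]. The sets [A]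
     admitting such an [l] form a filter, proper because [C] has no finite subcover. *)
  set (covers := fun (A : l2_car S -> Prop) l =>
    (forall U, In U l -> F U) /\ forall z, C z -> A z \/ exists U, In U l /\ U z).
  destruct (ultrafilter_exists _ (fun A => exists l, covers A l)) as [G [UG FG]].
  - intros [l [H1 H2]]. apply Hno. exists l. split; [exact H1|].
    intros z Hz. destruct (H2 z Hz) as [[]|H]. exact H.
  - exists nil. split; [intros U []|]. intros z _. left. exact I.
  - intros A A' [l [H1 H2]] [l' [H1' H2']]. exists (l ++ l'). split.
    + intros U HU. apply in_app_or in HU. destruct HU; auto.
    + intros z Hz. destruct (H2 z Hz) as [Az|[U [HU Uz]]].
      * destruct (H2' z Hz) as [Az'|[U [HU Uz]]]; [left; split; assumption|].
        right. exists U. split; [apply in_or_app; right|]; assumption.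
      * right. exists U. split; [apply in_or_app; left|]; assumption.
  - intros A A' HAA [l [H1 H2]]. exists l. split; [exact H1|].
    intros z Hz. destruct (H2 z Hz); auto.
  - assert (GC : G C).
    { apply FG. exists nil. split; [intros U []|]. intros z Hz. left. exact Hz. }
    assert (Hlim : forall s, exists x, forall eps, 0 < eps ->
      G (fun z : l2_car S => Rabs (z s - x) < eps)).
    { intros s. apply (uf_limit G (fun z : l2_car S => z s) (B + 1) UG).
      apply (uf_mono G UG C); [|exact GC]. intros z Hz.
      pose proof (sq_bounded_coord _ _ s (HB z Hz)) as H. apply Rabs_le. nra. }
    set (x := fun s => proj1_sig (constructive_indefinite_description _ (Hlim s))).
    assert (Hx : forall (l : list S) eps, 0 < eps ->
      G (fun z => C z /\ forall s, In s l -> Rabs (z s - x s) < eps)).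
    { intros l eps Heps. apply (uf_inter G UG); [exact GC|].
      apply (uf_forall_in G (fun s z => Rabs (z s - x s) < eps) l UG). intros s _.
      exact (proj2_sig (constructive_indefinite_description _ (Hlim s)) eps Heps). }
    assert (HxB : sq_bounded x B).
    { intros l Hl. apply fsum_sq_limit. intros eps Heps.
      destruct (uf_nonempty G UG _ (Hx l eps Heps)) as [z [Cz Hz]].
      exists z. split; [apply HB; assumption|exact Hz]. }
    set (p := exist _ x (ex_intro _ B HxB) : l2_car S).
    assert (Hp : forall V, weak_open (l2 S) V -> V p -> G (fun z => C z /\ V z)).
    { intros V HV Vp. destruct (weak_open_coords V B p HV HxB Vp) as [l [d [Hd H]]].
      eapply (uf_mono G UG); [|exact (Hx l d Hd)]. intros z [Cz Hz].
      split; [exact Cz|]. apply H; [exact (HB z Cz)|exact Hz]. }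
    assert (Cp : C p).
    { apply Hcl; [exact HxB|]. intros V HV Vp. exact (uf_nonempty G UG _ (Hp V HV Vp)). }
    destruct (Hcov p Cp) as [U [FU Up]].
    (* [U] alone covers [C] outside the complement of [U], so that complement is in [G]; but [G]
       converges weakly to [p], which lies in [U]. *)
    assert (GU : G (fun z => ~ U z)).
    { apply FG. exists (U :: nil). split.
      - intros U' [<-|[]]. exact FU.
      - intros z _. destruct (classic (U z)); [right|left; assumption].
        exists U. split; [left; reflexivity|assumption]. }
    destruct (uf_nonempty G UG _ (uf_inter G UG _ _ GU (Hp U (HF U FU) Up))) as [z [H1 [_ H2]]].
    exact (H1 H2).
Qed.

(** * Half-spaces, separation and coordinates in the weak topology *)

Lemma inner_0_l (H : Hilbert) (y : H) : inner H (hzero H) y = 0.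
Proof. pose proof (inner_add_l H (hzero H) (hzero H) y) as E. rewrite hadd_0 in E. lra. Qed.

Lemma inner_opp_l (H : Hilbert) (x y : H) : inner H (hopp H x) y = - inner H x y.
Proof.
  pose proof (inner_add_l H x (hopp H x) y) as E. rewrite hadd_opp, inner_0_l in E. lra.
Qed.

Lemma inner_sub_l (H : Hilbert) (x z y : H) :
  inner H (hadd H z (hopp H x)) y = inner H z y - inner H x y.
Proof. rewrite inner_add_l, inner_opp_l. lra. Qed.

Lemma weak_open_halfspace (H : Hilbert) (v : H) a : weak_open H (fun z => a < inner H z v).
Proof.
  intros x Hx. exists (v :: nil), (inner H x v - a). split; [lra|]. intros z Hz.
  specialize (Hz v (or_introl eq_refl)). rewrite inner_sub_l in Hz. apply Rabs_def2 in Hz. lra.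
Qed.

(** The hyperplane through the midpoint of [x] and [y] orthogonal to [v = x - y] separates them, as
    their products with [v] differ by [inner H v v > 0]. The opposite side is a half-space for
    [-v]. *)
Lemma weak_hausdorff (H : Hilbert) : hausdorff (weak H).
Proof.
  intros x y Hxy. simpl in x, y.
  set (v := hadd H x (hopp H y)).
  assert (Hv : 0 < inner H v v).
  { destruct (inner_pos H v) as [Hlt|E]; [exact Hlt|]. exfalso. apply Hxy.
    symmetry in E. apply inner_def in E. unfold v in E.
    rewrite <- (hadd_0 H y), <- E, <- hadd_assoc, (hadd_comm H (hopp H y)), hadd_opp.
    rewrite hadd_comm, hadd_0. reflexivity. }
  assert (Hd : inner H v v = inner H x v - inner H y v) by (unfold v at 1; apply inner_sub_l).
  set (m := (inner H x v + inner H y v) / 2).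
  assert (Hopp : forall z, inner H z (hopp H v) = - inner H z v).
  { intros z. rewrite inner_sym, inner_opp_l, inner_sym. reflexivity. }
  exists (fun z => m < inner H z v), (fun z => - m < inner H z (hopp H v)).
  split; [apply weak_open_halfspace|]. split; [apply weak_open_halfspace|].
  split; [unfold m; lra|]. split; [rewrite Hopp; unfold m; lra|].
  intros z [H1 H2]. rewrite Hopp in H2. lra.
Qed.

(** The product with a unit vector evaluates at [s]. Applied to the unit vector itself, this also
    gives its square summability. *)
Lemma delta_is_sum {S : Type} (f : S -> R) (s : S) :
  is_sum (fun t => f t * (if excluded_middle_informative (s = t) then 1 else 0)) (f s).
Proof.
  set (g := fun t => f t * (if excluded_middle_informative (s = t) then 1 else 0)).
  assert (H0 : forall l, ~ In s l -> fsum g l = 0).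
  { induction l as [|t l IH]; simpl; intros Hs; [reflexivity|].
    rewrite IH by tauto. unfold g. destruct (excluded_middle_informative (s = t)) as [->|_];
    [tauto|lra]. }
  intros eps Heps. exists (s :: nil). intros l Hnd Hl.
  destruct (incl_permutation (s :: nil) l) as [r Hr];
    [constructor; [intros []|constructor]|exact Hl|].
  rewrite (fsum_perm _ _ _ Hr). simpl. rewrite H0.
  - unfold g. destruct (excluded_middle_informative (s = s)); [|tauto].
    replace (f s * 1 + 0 - f s) with 0 by ring. rewrite Rabs_R0. exact Heps.
  - apply (Permutation_NoDup Hr) in Hnd. inversion Hnd; assumption.
Qed.

Lemma square_summable_delta {S : Type} (s : S) :
  square_summable (fun t => if excluded_middle_informative (s = t) then 1 else 0).
Proof.
  exists 1. intros l Hl.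
  set (f := fun t : S => if excluded_middle_informative (s = t) then 1 else 0).
  apply Rle_trans with (f s).
  - apply (is_sum_nonneg_ub (fun t => f t * f t)); [intros t; apply Rle_0_sqr| |exact Hl].
    exact (delta_is_sum f s).
  - unfold f. destruct (excluded_middle_informative (s = s)); lra.
Qed.

Lemma weak_open_coord {S : Type} (s : S) a : weak_open (l2 S) (fun z : l2_car S => a < z s).
Proof.
  pose proof (weak_open_halfspace (l2 S) (exist _ _ (square_summable_delta s)) a) as H.
  assert (E : forall z : l2_car S, l2_dot z (exist _ _ (square_summable_delta s)) = z s).
  { intros z. apply l2_dot_eq, delta_is_sum. }
  intros x Hx. destruct (H x) as [ys [eps [Heps Hys]]]; [simpl; rewrite E; exact Hx|].
  exists ys, eps. split; [exact Heps|]. intros z Hz. rewrite <- E. exact (Hys z Hz).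
Qed.

(** * Subspaces, and the weak closure as a compactification *)

Definition subspace (X : TopSpace) (P : X -> Prop) : TopSpace.
Proof.
  refine {| carrier := {x : X | P x};
    is_open := fun U => exists V, is_open X V /\ forall k, U k <-> V (proj1_sig k) |}.
  - exists (fun _ => True). split; [apply open_full|tauto].
  - intros U1 U2 [V1 [H1 E1]] [V2 [H2 E2]]. exists (fun x => V1 x /\ V2 x).
    split; [apply open_inter; assumption|]. intros k. rewrite E1, E2. tauto.
  - intros F HF.
    (* Joining all open sets that trace a member of [F] avoids choosing one for each member. *)
    exists (fun x => exists V, (is_open X V /\ exists U, F U /\ forall k, U k <-> V (proj1_sig k))
      /\ V x).
    split; [apply open_union; tauto|]. intros k. split.
    + intros [U [FU Uk]]. destruct (HF U FU) as [V [HV E]].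
      exists V. split; [split; eauto|]. apply E. exact Uk.
    + intros [V [[HV [U [FU E]]] Vk]]. exists U. split; [exact FU|]. apply E. exact Vk.
Defined.

Lemma subspace_embedding (X : TopSpace) (P : X -> Prop) :
  embedding (X := subspace X P) (Y := X) (@proj1_sig _ _).
Proof.
  split; [|split].
  - intros [x Hx] [y Hy]. simpl. intros <-. f_equal. apply proof_irrelevance.
  - intros V HV. exists V. split; [exact HV|tauto].
  - intros U HU. exact HU.
Qed.

Lemma subspace_hausdorff (X : TopSpace) (P : X -> Prop) : hausdorff X -> hausdorff (subspace X P).
Proof.
  intros HX x y Hxy. destruct (HX (proj1_sig x) (proj1_sig y)) as [U [V [HU [HV [Ux [Vy D]]]]]].
  - intros E. apply Hxy. apply (proj1 (subspace_embedding X P)). exact E.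
  - exists (fun k => U (proj1_sig k)), (fun k => V (proj1_sig k)).
    repeat split; try assumption.
    + exists U. split; [exact HU|tauto].
    + exists V. split; [exact HV|tauto].
    + intros z. apply D.
Qed.

Lemma subspace_compact (X : TopSpace) (P : X -> Prop) : compact_set P -> compact (subspace X P).
Proof.
  intros HP F HF Hcov.
  set (extends := fun V U => F U /\ forall k, U k <-> V (proj1_sig k)).
  destruct (HP (fun V => is_open X V /\ exists U, extends V U)) as [l [Hl1 Hl2]].
  - tauto.
  - intros x Px. destruct (Hcov (exist _ x Px) I) as [U [FU Ux]].
    destruct (HF U FU) as [V [HV E]]. exists V.
    split; [split; [exact HV|exists U; split; assumption]|]. apply (E (exist _ x Px)). exact Ux.
  - assert (exists l', (forall U, In U l' -> F U) /\
      forall V, In V l -> exists U, In U l' /\ extends V U) as [l' [H1 H2]].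
    { clear Hl2. induction l as [|V l IH]; [exists nil; split; intros ? []|].
      destruct IH as [l' [H1 H2]]; [intros V' HV'; apply Hl1; right; exact HV'|].
      destruct (Hl1 V (or_introl eq_refl)) as [_ [U HU]].
      exists (U :: l'). split.
      - intros U' [<-|HU']; [exact (proj1 HU)|auto].
      - intros V' [<-|HV']; [exists U; split; [left; reflexivity|exact HU]|].
        destruct (H2 V' HV') as [U' [HU' HE]]. exists U'. split; [right; exact HU'|exact HE]. }
    exists l'. split; [exact H1|]. intros k _.
    destruct (Hl2 (proj1_sig k) (proj2_sig k)) as [V [HV Vk]].
    destruct (H2 V HV) as [U [HU [_ E]]]. exists U. split; [exact HU|]. apply E. exact Vk.
Qed.

Lemma bounded_embedding_compactification (X : TopSpace) {S : Type} (e : X -> weak (l2 S)) B :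
  embedding e -> (forall x, sq_bounded (l2_val (e x)) B) ->
  exists K, uniform_eberlein K /\ compactification X K.
Proof.
  intros [einj [econt eopen]] HB.
  (* The points of the ball that lie in the weak closure of the image. The second conjunct is closed
     under a further closure, and it is exactly what density asks for. *)
  set (C := fun z : weak (l2 S) => sq_bounded (l2_val z) B /\
    forall V, weak_open (l2 S) V -> V z -> exists x, V (e x)).
  assert (HC : compact_set C).
  { apply (bounded_closed_compact C B); [intros z [Hz _]; exact Hz|].
    intros x Hx H. split; [exact Hx|]. intros V HV Vx.
    destruct (H V HV Vx) as [z [[_ Hz] Vz]]. exact (Hz V HV Vz). }
  assert (Ce : forall x, C (e x)) by (intros x; split; [apply HB|eauto]).
  exists (subspace (weak (l2 S)) C). split.
  - exists (l2 S), (@proj1_sig _ _). split; [apply subspace_embedding|].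
    intros F HF Hcov. destruct (HC F HF) as [l [H1 H2]].
    + intros x Cx. apply Hcov. exists (exist _ x Cx). reflexivity.
    + exists l. split; [exact H1|]. intros x [[k Ck] <-]. apply H2. exact Ck.
  - split; [apply subspace_compact, HC|]. split; [apply subspace_hausdorff, weak_hausdorff|].
    exists (fun x => exist _ (e x) (Ce x)). split; [split; [|split]|].
    + intros x y E. apply einj. exact (f_equal (@proj1_sig _ _) E).
    + intros U [V [HV E]].
      replace (fun x => U (exist _ (e x) (Ce x))) with (fun x => V (e x)).
      * apply econt, HV.
      * apply functional_extensionality. intros x.
        apply boolp.propositional_extensionality. symmetry. apply E.
    + intros U HU. destruct (eopen U HU) as [V [HV E]].
      exists (fun k => V (proj1_sig k)). split; [|exact E].
      exists V. split; [exact HV|tauto].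
    + intros U [V [HV E]] [[z [Hz1 Hz2]] Uz].
      destruct (Hz2 V HV) as [x Vx]; [apply (E (exist _ z (conj Hz1 Hz2))), Uz|].
      exists (exist _ (e x) (Ce x)). split; [apply E, Vx|]. exists x. reflexivity.
Qed.

(** * Bump functions at one scale from a well-ordering *)

Lemma total_order_max {T : Type} (le : T -> T -> Prop) (l : list T) :
  (forall x y z, le x y -> le y z -> le x z) -> (forall x y, le x y \/ le y x) ->
  l <> nil -> exists u l', Permutation l (u :: l') /\ forall t, In t l' -> le t u.
Proof.
  intros Htr Htot. induction l as [|s l IH]; intros Hne; [tauto|].
  destruct l as [|s' l0]; [exists s, nil; split; [reflexivity|intros ? []]|].
  destruct IH as [u [l' [HP Hu]]]; [discriminate|].
  destruct (Htot s u) as [H|H].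
  - exists u, (s :: l'). split.
    + rewrite HP. apply perm_swap.
    + intros t [<-|Ht]; auto.
  - exists s, (u :: l'). split; [rewrite HP; reflexivity|].
    intros t [<-|Ht]; [exact H|]. eauto.
Qed.

(* Well-order [T]. With [F t x = max 0 (r - d x t)] and [G s x = sup_(t < s) F t x], the functions
   [h s = max 0 (F s - G s)] are the increments of the transfinite sequence of suprema, so that
   their sum telescopes. At [x], the increment is positive for the least [s] such that
   [d x s < r]. *)
Lemma metric_partition {T : Type} (d : T -> T -> R) r : is_metric d -> 0 < r ->
  exists h : T -> T -> R,
    (forall s x, 0 <= h s x) /\
    (forall s x, 0 < h s x -> d x s < r) /\
    (forall x, exists s, 0 < h s x) /\
    (forall s x y, Rabs (h s x - h s y) <= 2 * d x y) /\
    (forall x l, NoDup l -> fsum (fun s => h s x) l <= r).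
Proof.
  intros [Hpos [Hsep [Hsym Htri]]] Hr.
  destruct (well_order_exists T) as [le [Htr [Hanti [Htot Hmin]]]].
  set (F := fun t x => Rmax 0 (r - d x t)).
  assert (HF0 : forall t x, 0 <= F t x) by (intros; apply Rmax_l).
  assert (HFr : forall t x, F t x <= r).
  { intros t x. apply Rmax_lub; [lra|]. pose proof (Hpos x t). lra. }
  assert (HFL : forall t x y, F t x <= F t y + d x y).
  { intros t x y. apply Rmax_lub.
    - pose proof (HF0 t y). pose proof (Hpos x y). lra.
    - pose proof (Rmax_r 0 (r - d y t)) as H. fold (F t y) in H.
      pose proof (Htri y x t). rewrite (Hsym y x) in *. lra. }
  (* Including 0 gives a supremum even when [s] is the least element, and makes [G] nonnegative. *)
  set (E := fun s x v => v = 0 \/ exists t, (le t s /\ t <> s) /\ v = F t x).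
  assert (Ebd : forall s x, bound (E s x)).
  { intros s x. exists r. intros v [->|[t [_ ->]]]; [lra|apply HFr]. }
  set (G := fun s x => proj1_sig (completeness (E s x) (Ebd s x)
    (ex_intro _ 0 (or_introl eq_refl)))).
  assert (HG : forall s x, is_lub (E s x) (G s x)).
  { intros s x. exact (proj2_sig (completeness _ _ _)). }
  assert (HG0 : forall s x, 0 <= G s x) by (intros s x; apply HG; left; reflexivity).
  assert (HFG : forall t s x, le t s -> t <> s -> F t x <= G s x).
  { intros t s x H1 H2. apply HG. right. exists t. tauto. }
  assert (HGle : forall s x c, 0 <= c -> (forall t, le t s -> t <> s -> F t x <= c) -> G s x <= c).
  { intros s x c Hc H. apply HG. intros v [->|[t [[H1 H2] ->]]]; auto. }
  assert (HGL : forall s x y, G s x <= G s y + d x y).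
  { intros s x y. apply HGle.
    - pose proof (HG0 s y). pose proof (Hpos x y). lra.
    - intros t H1 H2. pose proof (HFL t x y). pose proof (HFG t s y H1 H2). lra. }
  set (h := fun s x => Rmax 0 (F s x - G s x)).
  (* The truncation at 0 is needed because [F s] may lie below the earlier supremum. *)
  assert (Hh0 : forall s x, 0 <= h s x) by (intros; apply Rmax_l).
  assert (HhL : forall s x y, h s x <= h s y + 2 * d x y).
  { intros s x y. apply Rmax_lub.
    - pose proof (Hh0 s y). pose proof (Hpos x y). lra.
    - pose proof (Rmax_r 0 (F s y - G s y)) as H. fold (h s y) in H.
      pose proof (HFL s x y). pose proof (HGL s y x) as H'. rewrite (Hsym y x) in H'. lra. }
  exists h. repeat split.
  - exact Hh0.
  - intros s x H. apply Rnot_le_lt. intros N.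
    assert (F s x <= 0) by (apply Rmax_lub; lra).
    assert (h s x <= 0); [|lra]. apply Rmax_lub; [lra|]. pose proof (HG0 s x). lra.
  - intros x. destruct (Hmin (fun s => 0 < F s x)) as [s [Hs Hleast]].
    + exists x. eapply Rlt_le_trans; [|apply Rmax_r].
      rewrite (proj2 (Hsep x x) eq_refl). lra.
    + exists s. eapply Rlt_le_trans; [|apply Rmax_r].
      assert (G s x <= 0); [|lra]. apply HGle; [lra|]. intros t H1 H2.
      apply Rnot_lt_le. intros Hlt. apply H2, Hanti; [exact H1|]. apply Hleast, Hlt.
  - intros s x y. pose proof (HhL s x y) as H1. pose proof (HhL s y x) as H2.
    rewrite (Hsym y x) in H2. apply Rabs_le. lra.
  - intros x.
    (* Remove the greatest index [u]: for the smaller [t], both [F t x] and [G t x] are at most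
       [G u x], so their increments sum to at most [G u x], while [h u x <= c - G u x]. *)
    assert (Htel : forall n l c, length l = n -> NoDup l -> 0 <= c ->
      (forall t, In t l -> F t x <= c /\ G t x <= c) -> fsum (fun s => h s x) l <= c).
    { induction n as [|n IH]; intros l c Hn Hnd Hc Hl.
      - destruct l; [exact Hc|discriminate].
      - destruct (total_order_max le l Htr Htot) as [u [l' [HP Hu]]];
          [intros ->; discriminate|].
        rewrite (fsum_perm _ _ _ HP). simpl.
        apply (Permutation_NoDup HP) in Hnd. inversion Hnd as [|? ? Hnu Hnd']; subst.
        assert (fsum (fun s => h s x) l' <= G u x).
        { apply IH; auto.
          - apply Permutation_length in HP. simpl in HP. lia.
          - intros t Ht. assert (t <> u) by (intros ->; tauto).
            split; [auto|]. apply HGle; [apply HG0|]. intros t' H1 H2.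
            apply HFG; [eauto|]. intros ->. apply H2, Hanti; auto. }
        destruct (Hl u) as [H1 H2].
        { apply (Permutation_in _ (Permutation_sym HP)). left. reflexivity. }
        assert (h u x <= c - G u x); [|lra]. apply Rmax_lub; lra. }
    intros l Hl. apply (Htel (length l)); auto; [lra|]. intros t _. split; [apply HFr|].
    apply HGle; [lra|]. intros; apply HFr.
Qed.

(** * Summing over all scales, and the embedding *)

Lemma fsum_map {S T : Type} (a : T -> R) (g : S -> T) l :
  fsum a (map g l) = fsum (fun s => a (g s)) l.
Proof. induction l as [|s l IH]; simpl; [|rewrite IH]; reflexivity. Qed.

Lemma split_top_level {S : Type} M (l : list (nat * S)) :
  (forall p, In p l -> (fst p < Datatypes.S M)%nat) ->
  exists l1 l2, Permutation l (map (pair M) l1 ++ l2) /\ forall p, In p l2 -> (fst p < M)%nat.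
Proof.
  induction l as [|[m s] l IH]; intros H.
  - exists nil, nil. split; [reflexivity|intros ? []].
  - destruct IH as [l1 [l2 [HP H2]]]; [intros p Hp; apply H; right; exact Hp|].
    destruct (PeanoNat.Nat.eq_dec m M) as [->|Hm].
    + exists (s :: l1), l2. split; [simpl; rewrite HP; reflexivity|exact H2].
    + exists l1, ((m, s) :: l2). split.
      * rewrite <- Permutation_middle, HP. reflexivity.
      * intros p [<-|Hp]; [|auto]. simpl.
        pose proof (H (m, s) (or_introl eq_refl)) as Hlt. simpl in Hlt. lia.
Qed.

(** The bound is the geometric sum of [(1 / 2) ^ m] over [m < M]; each induction step splits off the
    highest level. *)
Lemma fsum_levels {S : Type} (a : nat * S -> R) (M : nat) l :
  (forall m l, NoDup l -> fsum (fun s => a (m, s)) l <= (1 / 2) ^ m) ->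
  NoDup l -> (forall p, In p l -> (fst p < M)%nat) ->
  fsum a l <= 2 - 2 * (1 / 2) ^ M.
Proof.
  intros Ha. revert l. induction M as [|M IH]; intros l Hnd Hl.
  - destruct l as [|p l]; [simpl; lra|]. specialize (Hl p (or_introl eq_refl)). lia.
  - destruct (split_top_level M l Hl) as [l1 [l2 [HP H2]]].
    apply (Permutation_NoDup HP) in Hnd. rewrite (fsum_perm _ _ _ HP), fsum_app, fsum_map.
    specialize (IH l2 (NoDup_app_remove_l _ _ Hnd) H2).
    specialize (Ha M l1 (NoDup_map_inv _ _ (NoDup_app_remove_r _ _ Hnd))). simpl. lra.
Qed.

Lemma fst_bounded {S : Type} (l : list (nat * S)) :
  exists M, forall p, In p l -> (fst p < M)%nat.
Proof.
  induction l as [|q l [M H]]; [exists O; intros ? []|].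
  exists (Datatypes.S (max M (fst q))). intros p [<-|Hp]; [lia|]. specialize (H p Hp). lia.
Qed.

Theorem theorem1 : forall X : TopSpace, metrizable X ->
  exists K : TopSpace, uniform_eberlein K /\ compactification X K.
Proof.
  intros X [d [Hd Hopen]].
  pose proof Hd as [Hpos [Hsep [Hsym Htri]]].
  assert (Hpow : forall m, 0 < (1 / 2) ^ m <= 1).
  { induction m as [|m IH]; simpl; lra. }
  set (hs := fun m => constructive_indefinite_description _
    (metric_partition d _ Hd (proj1 (Hpow m)))).
  set (h := fun m => proj1_sig (hs m)).
  assert (h_spec : forall m,
    (forall s x, 0 <= h m s x) /\
    (forall s x, 0 < h m s x -> d x s < (1 / 2) ^ m) /\
    (forall x, exists s, 0 < h m s x) /\
    (forall s x y, Rabs (h m s x - h m s y) <= 2 * d x y) /\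
    (forall x l, NoDup l -> fsum (fun s => h m s x) l <= (1 / 2) ^ m)).
  { intros m. exact (proj2_sig (hs m)). }
  clearbody h. clear hs.
  set (c := fun x (p : nat * X) => h (fst p) (snd p) x).
  assert (Hc : forall x, sq_bounded (c x) 2).
  { intros x l Hl. destruct (fst_bounded l) as [M HM].
    apply Rle_trans with (2 - 2 * (1 / 2) ^ M); [|pose proof (Hpow M); lra].
    apply (fsum_levels (fun p => c x p * c x p)); [|exact Hl|exact HM].
    clear l Hl M HM. intros m l Hl. destruct (h_spec m) as [H0 [_ [_ [_ Hsum]]]].
    (* A single value is at most [(1 / 2) ^ m <= 1], so its square is at most the value itself. *)
    apply Rle_trans with (fsum (fun s => h m s x) l); [|auto].
    apply fsum_le. intros s _. unfold c. simpl. pose proof (H0 s x).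
    assert (h m s x <= 1); [|nra].
    specialize (Hsum x (s :: nil)). simpl in Hsum. pose proof (Hpow m).
    assert (h m s x + 0 <= (1 / 2) ^ m); [|lra].
    apply Hsum. constructor; [intros []|constructor]. }
  set (e := fun x => exist _ (c x) (ex_intro _ 2 (Hc x)) : weak (l2 (nat * X))).
  assert (Hbase : forall x eps, 0 < eps -> exists p, 0 < c x p /\
    forall y, 0 < c y p -> d x y < eps).
  { intros x eps Heps.
    (* With [(1 / 2) ^ m < eps / 2], two points where [h m s] is positive are both that close to
       [s], hence within [eps] of each other. *)
    destruct (pow_lt_1_zero (1 / 2) ltac:(rewrite Rabs_pos_eq; lra) (eps / 2) ltac:(lra))
      as [m Hm].
    specialize (Hm m (le_n m)). apply Rabs_def2 in Hm.
    destruct (h_spec m) as [_ [Hsupp [Hex _]]]. destruct (Hex x) as [s Hs].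
    exists (m, s). split; [exact Hs|]. intros y Hy. unfold c in Hy. simpl in Hy.
    apply Hsupp in Hs, Hy. pose proof (Htri x s y). rewrite (Hsym s y) in *. lra. }
  apply (bounded_embedding_compactification X e 2); [|exact Hc].
  split; [|split].
  - intros x y E. apply NNPP. intros Hxy.
    assert (Hdxy : 0 < d x y).
    { destruct (Hpos x y) as [H|H]; [exact H|]. exfalso. apply Hxy, Hsep. congruence. }
    destruct (Hbase x (d x y) Hdxy) as [p [Hp Hy]].
    apply (f_equal (fun f : l2_car _ => f p)) in E. simpl in E. rewrite E in Hp.
    specialize (Hy y Hp). lra.
  - intros V HV. apply Hopen. intros x Vx.
    destruct (weak_open_coords V 2 (e x) HV (Hc x) Vx) as [l [delta [Hdelta Hl]]].
    (* All coordinates share the Lipschitz constant 2, so the radius is independent of the list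
       [l]. *)
    exists (delta / 2). split; [lra|]. intros y Hxy. apply Hl; [exact (Hc y)|].
    intros [m s] _. simpl. unfold c. simpl.
    destruct (h_spec m) as [_ [_ [_ [HL _]]]]. specialize (HL s y x).
    rewrite (Hsym y x) in HL. lra.
  - intros U HU.
    (* The largest weakly open set whose preimage under [e] lies in [U]; the coordinate sets of
       [Hbase] show that it reaches every point of [U]. *)
    exists (fun z : l2_car (nat * X) => exists V,
      (weak_open (l2 (nat * X)) V /\ forall y, V (e y) -> U y) /\ V z).
    split; [apply (open_union (weak (l2 (nat * X)))); tauto|].
    intros x. split; [|intros [V [[_ H] Vx]]; auto].
    intros Ux. destruct (proj1 (Hopen U) HU x Ux) as [eps [Heps Hball]].
    destruct (Hbase x eps Heps) as [p [Hp Hy]].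
    exists (fun z : l2_car (nat * X) => 0 < z p). split; [split|exact Hp].
    + apply weak_open_coord.
    + intros y Vy. apply Hball, Hy, Vy.
Qed.
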